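(* For every integer $n\ge 11$, $$\min\{f(P(n),M): M\in\mathcal{M}_2(P(n))\}=\left\lceil \frac{n}{12}\right\rceil+1 .$$
   Context: For $n\ge 3$, $P(n)=P(n,2)$ is the simple graph with vertex set $\{u_i,v_i:0\le i\le n-1\}$ and edge set $\{u_iu_{i+2},\,u_iv_i,\,v_iv_{i+1}:0\le i\le n-1\}$, subscripts modulo $n$. The edges $u_iv_i$ are called spokes. For a perfect matching $M$ of a graph $G$, a forcing set of $M$ is a subset $S\subseteq M$ contained in no perfect matching of $G$ other than $M$; the forcing number $f(G,M)$ is the minimum cardinality of a forcing set of $M$. $\mathcal{M}_2(P(n))$ is the set of perfect matchings $M$ of $P(n)$ such that either (i) $M$ contains at least one spoke, and for any two (cyclically) consecutive spokes $u_iv_i,u_jv_j$ of $M$ the number of spokes $u_kv_k$ of $P(n)$ strictly between them, $j-i-1$ (with $j$ taken as the representative in $(i,i+n]$), is $\equiv 2\pmod 4$ (if $M$ has exactly one spoke $u_iv_i$, it is regarded as two consecutive spokes with $j=i+n$, so the number is $n-1$); or (ii) $M$ contains no spoke, $4\mid n$, and for some $i$, $M=\bigcup_{k=0}^{n/4-1}\{u_{i+4k}u_{i+4k+2},\,u_{i+4k+1}u_{i+4k+3},\,v_{i+4k+1}v_{i+4k+2},\,v_{i+4k+3}v_{i+4k+4}\}$. *)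

(* Defs.v *)
From mathcomp Require Import all_boot all_order all_algebra.

Set Implicit Arguments.
Unset Strict Implicit.
Unset Printing Implicit Defensive.

Local Open Scope nat_scope.

(* A simple graph on T is given by its edge set E : {set {set T}}, each edge
   being the two-element set of its end points. *)
Section Forcing.

Variables (T : finType) (E : {set {set T}}).
Implicit Types M S : {set {set T}}.

Definition perfect_matching M : bool :=
  [&& M \subset E, trivIset M & cover M == [set: T]].

Definition forcing_set M S : bool :=
  (S \subset M) &&
  [forall M', perfect_matching M' && (S \subset M') ==> (M' == M)].

(* [arg min_(S < M | P) F] yields a true minimizer only when P M holds; when M
   is a perfect matching of a simple graph this is forcing_set_refl below. *)
Definition forcing_number M : nat :=
  #|[arg min_(S < M | forcing_set M S) #|S| ]|.

Lemma forcing_set_refl M :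
  set0 \notin E -> perfect_matching M -> forcing_set M M.
Proof.
move=> E0 /and3P[sME tM /eqP cM]; rewrite /forcing_set subxx /=.
apply/forallP=> M'; apply/implyP=> /andP[/and3P[sM'E tM' _] sMM'].
rewrite eqEsubset sMM' andbT; apply/subsetP=> e eM'.
have /set0Pn[x xe] : e != set0.
  by apply: contraNneq E0 => <-; apply: (subsetP sM'E).
have : x \in cover M by rewrite cM inE.
case/bigcupP=> e' e'M xe'.
by rewrite -(def_pblock tM' eM' xe) (def_pblock tM' (subsetP sMM' _ e'M) xe').
Qed.

End Forcing.

Section GeneralizedPetersen.

Variable n : nat.

Lemma ord_shift_subproof (i : 'I_n) (k : nat) : (i + k) %% n < n.
Proof. by rewrite ltn_pmod // (leq_ltn_trans _ (ltn_ord i)). Qed.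

(* The subscript i + k modulo n. *)
Definition ord_shift (i : 'I_n) (k : nat) : 'I_n :=
  Ordinal (ord_shift_subproof i k).

Local Notation "i +% k" := (ord_shift i k) (at level 50, left associativity).

Definition vertex : finType := ('I_n + 'I_n)%type.
Definition u (i : 'I_n) : vertex := inl i.
Definition v (i : 'I_n) : vertex := inr i.

Definition spoke (i : 'I_n) : {set vertex} := [set u i; v i].

(* The edge set of P(n, 2); for n >= 3 every edge has two distinct ends. *)
Definition petersen2 : {set {set vertex}} :=
  [set [set u i; u (i +% 2)] | i : 'I_n]
  :|: [set spoke i | i : 'I_n]
  :|: [set [set v i; v (i +% 1)] | i : 'I_n].

(* The spokes of M at i and i +% d are consecutive, where i + d is the
   representative in (i, i + n] of the second index; d = n occurs exactly when
   the spoke at i is the only one of M. *)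
Definition consecutive_spokes (M : {set {set vertex}}) (i : 'I_n) (d : nat) :=
  [/\ 0 < d <= n, spoke i \in M, spoke (i +% d) \in M &
      forall k, 0 < k < d -> spoke (i +% k) \notin M].

Definition spokeless_matching (i : 'I_n) : {set {set vertex}} :=
  \bigcup_(k < n %/ 4)
    [set [set u (i +% (4 * k)); u (i +% (4 * k + 2))];
         [set u (i +% (4 * k + 1)); u (i +% (4 * k + 3))];
         [set v (i +% (4 * k + 1)); v (i +% (4 * k + 2))];
         [set v (i +% (4 * k + 3)); v (i +% (4 * k + 4))]].

Definition matching_class2 (M : {set {set vertex}}) : Prop :=
  perfect_matching petersen2 M /\
  ([/\ exists i, spoke i \in M &
       forall i d, consecutive_spokes M i d -> d - 1 = 2 %[mod 4]] \/
   [/\ forall i, spoke i \notin M, 4 %| n &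
       exists i, M = spokeless_matching i]).

End GeneralizedPetersen.

(* Main.v *)
From Stdlib Require Import NArith ZArith.
Require Import Defs.
From mathcomp Require Import all_boot zify.

Set Implicit Arguments.
Unset Strict Implicit.
Unset Printing Implicit Defensive.

(* A perfect matching of P(n,2) is a closed walk of length n in an automaton on
   eight states: cut the graph between the positions i and i + 1 and record
   which of v_i v_(i+1), u_i u_(i+2), u_(i-1) u_(i+1) are in the matching.  A step
   preserves the parity of the state; M_2 consists of the walks of odd parity.
   These pass through the state A = (0,0,1), between two visits of which they
   are cut into blocks of length 3 (ending with a spoke) and 4 (spokeless).

   Upper bound.  The edge u_x u_(x+2) and the spoke at x + 1 force the state A,
   and then spokes at distances 6, 7, 9, 11 or 12 force the walk, because there
   is a single way to go from A to a spoke in that number of steps.  Every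
   n >= 11 is a sum of exactly ceil(n / 12) such distances.

   Lower bound.  Follow M from A, keeping only: the state of M, the number of
   edges of S met so far (up to 2), and which pairs (start, current state) are
   joined by a walk containing the edges of S met so far, other than M's own
   walk.  If S is forcing, no such rival walk closes up.  A finite table of
   these data, each with a lower bound for 12 |S| - (length), is closed under
   steps up to dominance, and it shows 12 |S| - n >= 12 at the end. *)

Local Notation "i +% k" := (ord_shift i k) (at level 50, left associativity).

(** * The automaton and its table of summaries *)

(* A state lists the cut edges (v_i v_(i+1), u_i u_(i+2), u_(i-1) u_(i+1)); a
   letter lists the edges (v_i v_(i+1), u_i u_(i+2), spoke i) of one position,
   as used by a step or as required by a forcing set. *)
Definition state : Type := (bool * bool * bool)%type.
Definition letter : Type := (bool * bool * bool)%type.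

Definition step (q t : state) : bool :=
  let: (a, b, c) := q in let: (a', b', c') := t in
  [&& c' == b, ~~ (a && a'), ~~ (c && b') & (a || a') == (c || b')].

Definition used (q t : state) : letter :=
  (t.1.1, t.1.2, ~~ (q.1.1 || t.1.1)).

Definition sub_letter (l e : letter) : bool :=
  [&& l.1.1 ==> e.1.1, l.1.2 ==> e.1.2 & l.2 ==> e.2].

Definition allows (l : letter) (q t : state) : bool :=
  step q t && sub_letter l (used q t).

Fixpoint run (q : state) (ls : seq letter) (p : seq state) : bool :=
  match ls, p with
  | [::], [::] => true
  | l :: ls', t :: p' => allows l q t && run t ls' p'
  | _, _ => false
  end.

Definition letter_size (l : letter) : nat := l.1.1 + l.1.2 + l.2.

(** Listed by increasing [code], so that a table mapped over [bools3] can be read at index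
    [code t]. *)
Definition bools3 : seq (bool * bool * bool) :=
  [seq (bc, c) | bc <- [seq (a, b) | a <- [:: false; true], b <- [:: false; true]],
                 c <- [:: false; true]].

Definition code (q : state) : nat :=
  let: (a, b, c) := q in 4 * a + 2 * b + c.
Definition bit (q : state) : N := N.of_nat (code q).

Definition base : state := (false, false, true).

(* [capped] is the number of forced edges, truncated at 2; [bound] is at most 12
   times that number minus the length; bit [bit q] of the column of [t] is set
   when a rival walk from [q] to [t] is guaranteed.  The cap isolates the
   short matchings with a single forced edge, for which the final bound 12 fails. *)
Record entry := Entry { current : state; capped : nat; bound : Z; columns : seq N }.

Definition column (R : seq N) (t : state) : N := nth N0 R (code t).

(** A step into [t] fixes the second component of its source, hence only four candidates [s]. The
    extra bit records the rival that follows the matching from [base] up to now and leaves it at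
    this step. *)
Definition advance (m m' : state) (l : letter) (R : seq N) : seq N :=
  [seq foldr N.lor
     (if allows l m t && (t != m') then N.shiftl 1 (bit base) else N0)
     [seq column R s | s <- [seq (a, t.2, c) | a <- [:: false; true], c <- [:: false; true]]
                  & allows l s t]
   | t <- bools3].

Definition succs (e : entry) : seq entry :=
  [seq Entry t (minn 2 (capped e + letter_size l))
         (bound e + (12 * Z.of_nat (letter_size l) - 1))%Z
         (advance (current e) t l (columns e))
  | t <- [seq t <- bools3 | step (current e) t],
    l <- [seq l <- bools3 | sub_letter l (used (current e) t)]].

(** In a dead entry a rival from [base] has rejoined the matching's own walk; continued along that
    walk, it closes up. *)
Definition alive (e : entry) : bool :=
  ~~ N.testbit (column (columns e) (current e)) (bit base).

(** Here [e] is the weaker summary: its bound is no larger and its rival pairs are among those of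
    [f], so whatever [f] describes is also described by [e]. *)
Definition dominates (e f : entry) : bool :=
  [&& current e == current f, capped e == capped f, (bound e <=? bound f)%Z &
      all2 (fun x y => N.eqb (N.ldiff x y) 0) (columns e) (columns f)].

Definition initial : entry :=
  Entry base 0 0 [seq (if t == base then N0 else N.shiftl 1 (bit t)) | t <- bools3].

(** Below the cap, [capped e] is the exact number of forced edges, and the first inequality makes
    the length less than 11. *)
Definition closed_bound (e : entry) : bool :=
  [|| current e != base, has (fun q => N.testbit (column (columns e) q) (bit q)) bools3
   | if capped e < 2 then (12 * Z.of_nat (capped e) - 11 <? bound e)%Z else (12 <=? bound e)%Z].

Definition certified (T : seq entry) : bool :=
  [&& has (dominates^~ initial) T,
      all (fun e => all (fun f => alive f ==> has (dominates^~ f) T) (succs e)) T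
    & all closed_bound T].

Definition insert (T : seq entry) (e : entry) : seq entry :=
  if has (dominates^~ e) T then T else e :: [seq f <- T | ~~ dominates e f].

(* Nothing is proved about [insert] and [saturate]: the table that they produce
   is validated by [certified]. *)
Fixpoint saturate (fuel : nat) (T new : seq entry) : seq entry :=
  if fuel is fuel'.+1 then
    let new' := foldl insert [::]
      [seq f <- flatten [seq succs e | e <- new]
         | alive f && ~~ has (dominates^~ f) T] in
    if new' is [::] then T else saturate fuel' (foldl insert T new') new'
  else T.

Definition table := Eval vm_compute in saturate 100 [:: initial] [:: initial].
Lemma table_certified : certified table. Proof. by vm_compute. Qed.

(** * Soundness of the table *)

Local Arguments Z.mul : simpl never.

Lemma mem_bools3 t : t \in bools3.
Proof. by case: t => -[[] []] []. Qed.

Lemma run_rcons q ls p l t :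
  run q ls p -> run q (rcons ls l) (rcons p t) = allows l (last q p) t.
Proof.
elim: ls q p => [|l' ls IH] q [|t' p] //=; first by rewrite andbT.
by case/andP=> -> /IH.
Qed.

Lemma run_size q ls p : run q ls p -> size ls = size p.
Proof. by elim: ls q p => [|l ls IH] q [|t p] //= /andP[_ /IH->]. Qed.

Lemma run_cat q ls1 ls2 p1 p2 : size ls1 = size p1 ->
  run q (ls1 ++ ls2) (p1 ++ p2) = run q ls1 p1 && run (last q p1) ls2 p2.
Proof.
elim: ls1 q p1 => [|l ls1 IH] q [|t p1] //= [sz].
by rewrite IH // andbA.
Qed.

Lemma run_step q ls p : run q ls p -> path step q p.
Proof.
by elim: ls q p => [|l ls IH] q [|t p] //= /andP[/andP[-> _] /IH].
Qed.

Lemma column_map (F : state -> N) t : column [seq F s | s <- bools3] t = F t.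
Proof. by case: t => -[[] []] []. Qed.

Lemma testbit_bit q q' : N.testbit (N.shiftl 1 (bit q)) (bit q') = (q == q').
Proof. by case: q => -[[] []] []; case: q' => -[[] []] []. Qed.

Lemma testbit_foldr x xs i :
  N.testbit (foldr N.lor x xs) i = N.testbit x i || has (N.testbit^~ i) xs.
Proof.
elim: xs => [|y xs IH] /=; first by rewrite orbF.
by rewrite N.lor_spec IH -/(orb _ _); case: (N.testbit y i); case: (N.testbit x i).
Qed.

(** From a start other than [base] every walk is a rival, since the matching's own walk starts at
    [base]. *)
Definition rival (w : seq (letter * state)) (q t : state) : Prop :=
  exists p, [/\ run q (unzip1 w) p, last q p = t & q = base -> p <> unzip2 w].

Definition num_forced (ls : seq letter) : nat := sumn (map letter_size ls).

Definition covers (e : entry) (w : seq (letter * state)) : Prop :=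
  [/\ current e = last base (unzip2 w), capped e = minn 2 (num_forced (unzip1 w)),
      (bound e <= 12 * Z.of_nat (num_forced (unzip1 w)) - Z.of_nat (size w))%Z &
      forall q t, N.testbit (column (columns e) t) (bit q) -> rival w q t].

Lemma covers_initial : covers initial [::].
Proof.
split=> // q t; rewrite column_map; case: eqP => // tb; rewrite testbit_bit => /eqP qt.
by exists [::]; split=> // qb; case: tb; rewrite qt.
Qed.

Lemma covers_dominates e f w : dominates e f -> covers f w -> covers e w.
Proof.
case/and4P=> /eqP ce /eqP ne /Z.leb_spec0 we ale [cf nf wf rf]; split.
- by rewrite ce.
- by rewrite ne.
- lia.
move=> q t etq; apply: rf; move: etq; rewrite /column.
elim: (columns e) (columns f) (code t) ale => [|x xs IH] [|y ys] [|k] //=.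
- move=> /andP[/N.eqb_spec xy _].
  move/(congr1 (N.testbit^~ (bit q))): xy; rewrite N.ldiff_spec N.bits_0.
  by move=> h xq; move: h; rewrite xq; case: N.testbit.
- by case/andP=> _ /IH h /h.
Qed.

Lemma num_forced_rcons ls l : num_forced (rcons ls l) = num_forced ls + letter_size l.
Proof. by rewrite /num_forced map_rcons sumn_rcons. Qed.

Lemma unzip1_rcons (T U : Type) (w : seq (T * U)) x :
  unzip1 (rcons w x) = rcons (unzip1 w) x.1.
Proof. exact: map_rcons. Qed.

Lemma unzip2_rcons (T U : Type) (w : seq (T * U)) x :
  unzip2 (rcons w x) = rcons (unzip2 w) x.2.
Proof. exact: map_rcons. Qed.

Lemma all_flatten_map (T : eqType) (U : Type) (P : pred U) (F : T -> seq U) xs x :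
  all P (flatten (map F xs)) -> x \in xs -> all P (F x).
Proof.
elim: xs => //= y xs IH; rewrite all_cat inE => /andP[Py /IH h].
by case/orP=> [/eqP->|/h].
Qed.

Lemma all_has (T : Type) (P Q : pred T) xs :
  all P xs -> has Q xs -> exists2 x, P x & Q x.
Proof.
by elim: xs => //= x xs IH /andP[Px /IH h] /orP[Qx|/h]; [exists x|].
Qed.

Lemma all_succs (P : pred entry) e t l :
  all P (succs e) -> step (current e) t -> sub_letter l (used (current e) t) ->
  P (Entry t (minn 2 (capped e + letter_size l))
       (bound e + (12 * Z.of_nat (letter_size l) - 1)) (advance (current e) t l (columns e))).
Proof.
rewrite /succs => Pe et lt.
have /(all_flatten_map Pe) : t \in [seq t <- bools3 | step (current e) t].
  by rewrite mem_filter et mem_bools3.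
rewrite all_map => /allP /(_ l); apply.
by rewrite mem_filter lt mem_bools3.
Qed.

Lemma rival_rcons w q s t t' l :
  rival w q s -> allows l s t' -> rival (rcons w (l, t)) q t'.
Proof.
case=> p [rp ps pw] st; exists (rcons p t').
split; rewrite ?last_rcons // ?unzip1_rcons ?unzip2_rcons ?run_rcons ?ps //=.
by move=> qb /rcons_inj[/(pw qb)].
Qed.

(** Each bit set by [advance] has a witness: a walk parting from the matching at this very step, or
    an older rival prolonged, which stays different. *)
Lemma covers_succ e w l t :
  covers e w -> run base (unzip1 w) (unzip2 w) -> allows l (last base (unzip2 w)) t ->
  covers (Entry t (minn 2 (capped e + letter_size l))
       (bound e + (12 * Z.of_nat (letter_size l) - 1)) (advance (current e) t l (columns e)))
    (rcons w (l, t)).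
Proof.
case=> ce ne we re rM lt; split=> /=.
- by rewrite unzip2_rcons last_rcons.
- by rewrite ne unzip1_rcons num_forced_rcons /=; lia.
- rewrite unzip1_rcons num_forced_rcons size_rcons -[(l, t).1]/l.
  by move: we => /=; lia.
move=> q t'; rewrite /advance column_map testbit_foldr => /orP[|].
  case: ifP => [/andP[lt' tt']|_]; last by rewrite N.bits_0.
  rewrite testbit_bit => /eqP <-.
  exists (rcons (unzip2 w) t').
  rewrite last_rcons unzip1_rcons unzip2_rcons run_rcons //= -ce; split=> // _.
  by case/rcons_inj=> /eqP; rewrite (negPf tt').
case/hasP=> x /mapP[s]; rewrite mem_filter => /andP[ls _] -> /re rs.
exact: rival_rcons rs ls.
Qed.

Definition unrivaled (ls : seq letter) (p : seq state) : Prop :=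
  forall q p', run q ls p' -> last q p' = q -> q = base /\ p' = p.

(** Some table entry covers the whole walk. The walk ends at [base] and has no closed rival, so of
    the three alternatives in [closed_bound] only the numerical one remains. *)
Lemma unrivaled_num_forced ls p :
  run base ls p -> last base p = base -> unrivaled ls p -> 11 <= size ls ->
  size ls + 12 <= 12 * num_forced ls.
Proof.
move=> rp lp up sz; have sp := run_size rp.
have /and3P[] := table_certified; move: table => T T0 TS Tok.
pose w := zip ls p.
have e1 : unzip1 w = ls by rewrite unzip1_zip ?sp.
have e2 : unzip2 w = p by rewrite unzip2_zip ?sp.
pose good e := all (fun f => alive f ==> has (dominates^~ f) T) (succs e) && closed_bound e.
have Tgood : all good T by rewrite all_predI TS Tok.
(* Induction on the prefix [w1]; the remainder [w2] is kept in order to close up rivals. *)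
have cov w1 w2 : w = w1 ++ w2 -> exists2 e, good e & covers e w1.
  elim/last_ind: w1 w2 => [|w1 [l t] IH] w2 ew.
    by have [e ge /covers_dominates/(_ covers_initial)] := all_has Tgood T0; exists e.
  have [|e ge ce] := IH ((l, t) :: w2); first by rewrite ew cat_rcons.
  have szw : size (unzip1 w1) = size (unzip2 w1) by rewrite !size_map.
  move: (rp); rewrite -e1 -e2 ew /unzip1 /unzip2 !map_cat !map_rcons /= !cat_rcons.
  rewrite run_cat //= => /and3P[r1 lt r2].
  have cf := covers_succ ce r1 lt.
  have [st sl] : step (current e) t /\ sub_letter l (used (current e) t).
    by have [-> _ _ _] := ce; apply/andP.
  have /andP[/all_succs/(_ st sl) dead _] := ge.
  case: (boolP (alive _)) dead => [_|] /=.
    case/(all_has Tgood) => f gf /covers_dominates df.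
    by exists f => //; apply: df.
  (* A dead successor yields a rival of the prefix ending in the same state; followed by [w2] it
     contradicts [unrivaled]. *)
  rewrite negbK; case: cf => _ _ _ h /h /=.
  case=> p' [rp' lp' /(_ erefl) np']; case: np'.
  have szp' := run_size rp'.
  have [||_] := up base (p' ++ unzip2 w2).
  - by rewrite -e1 ew /unzip1 map_cat run_cat // rp' lp'.
  - by rewrite last_cat lp' -[RHS]lp -e2 ew /unzip2 map_cat last_cat map_rcons last_rcons.
  rewrite -e2 ew /unzip2 map_cat => /eqP; rewrite eqseq_cat.
    by case/andP=> /eqP.
  by rewrite -szp' !size_map.
have [|e /andP[_ ok] [ce ne we re]] := cov w [::]; first by rewrite cats0.
move: ok ce ne we re; rewrite e1 e2 lp /closed_bound => ok ce ne we re.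
case/or3P: ok; first by rewrite ce.
- case/hasP=> q _ /re[p' [rp' lp' np']].
  by rewrite e1 e2 in rp' np'; have [qb pp] := up _ _ rp' lp'; case: np'.
- have sw : size w = size ls by rewrite size_zip -sp minnn.
  rewrite ne sw in we *; by case: ifP => h; [move/Z.ltb_spec0|move/Z.leb_spec0]; lia.
Qed.

(** * Perfect matchings as closed walks *)

Lemma perfect_matchingE (T : finType) (E M : {set {set T}}) :
  perfect_matching E M = (M \subset E) && [forall x, #|[set e in M | x \in e]| == 1].
Proof.
rewrite /perfect_matching; congr andb; apply/andP/forallP => [[tM /eqP cM] x|one].
  have /bigcupP[e eM xe] : x \in cover M by rewrite cM inE.
  apply/cards1P; exists e; apply/setP=> f; rewrite !inE.
  apply/andP/eqP => [[fM xf]|-> //].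
  by rewrite -(def_pblock tM eM xe) (def_pblock tM fM xf).
split.
  apply/trivIsetP => e f eM fM; apply: contraNT => /pred0Pn[x /= /andP[xe xf]].
  have /cards1P[g /setP eg] := one x.
  by move: (eg e) (eg f); rewrite !inE eM fM xe xf /= => /esym/eqP-> /esym/eqP->.
apply/eqP/setP=> x; rewrite inE; have /cards1P[g /setP/(_ g)] := one x.
by rewrite !inE eqxx => /andP[gM xg]; apply/bigcupP; exists g.
Qed.

(** Turns the degree condition at a vertex into membership bits of an explicit list of its edges. *)
Lemma card_incident (T : finType) (E M : {set {set T}}) x (es : seq {set T}) :
  M \subset E -> uniq es -> {in E, forall e : {set T}, (x \in e) = (e \in es)} ->
  #|[set e in M | x \in e]| = count (mem M) es.
Proof.
move=> sME ues inc; rewrite -size_filter -(card_uniqP _) ?filter_uniq //.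
apply: eq_card => e; rewrite !inE mem_filter /=.
by case: (boolP (e \in M)) => // /(subsetP sME)/inc.
Qed.

(** * Subscripts modulo n *)

Section Shift.
Variable n : nat.
Implicit Types i j x : 'I_n.

Lemma shift_shift i k l : i +% k +% l = i +% (k + l).
Proof. by apply: val_inj; rewrite /= modnDml addnA. Qed.

Lemma shift0 i : i +% 0 = i.
Proof. by apply: val_inj; rewrite /= addn0 modn_small. Qed.

Lemma eq_shift i k l : (i +% k == i +% l) = (k == l %[mod n]).
Proof. by rewrite -val_eqE /= eqn_modDl. Qed.

Lemma shift_addn i k : i +% (k + n) = i +% k.
Proof. by apply/eqP; rewrite eq_shift modnDr. Qed.

Lemma shift_neq i k : 0 < k < n -> i +% k != i.
Proof.
case/andP=> k0 kn; rewrite -{2}(shift0 i) eq_shift mod0n modn_small //.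
by rewrite -lt0n.
Qed.

Lemma shift_inj k : injective (fun i => i +% k).
Proof.
move=> i j /(congr1 val) /= /eqP; rewrite eqn_modDr !modn_small // => /eqP.
exact: val_inj.
Qed.

Lemma shift_surj x m i : exists2 k, k < n & i = x +% (k + m).
Proof.
have n0 : 0 < n by apply: leq_ltn_trans (ltn_ord i).
(* This is i - x - m modulo n, with [n - x] and [m * n.-1] standing for -x and -m. *)
exists ((i + (n - x) + m * n.-1) %% n); first by rewrite ltn_pmod.
apply: val_inj; rewrite /= addnCA modnDml.
have -> : i + (n - x) + m * n.-1 + (x + m) = m.+1 * n + i.
  have e : m + m * n.-1 = m * n by rewrite -mulnS prednK.
  by have := ltn_ord x; rewrite mulSn; lia.
by rewrite modnMDl modn_small.
Qed.

End Shift.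

Section Chords.
Variables (n k : nat) (f : 'I_n -> vertex n).
Hypotheses (fI : injective f) (k0 : 0 < k) (kn : k.*2 < n).

Definition chord (i : 'I_n) : {set vertex n} := [set f i; f (i +% k)].

(** Equal chords at distinct [i] and [j] would give i = j + k and j = i + k, so n would divide 2k.
    For the inner edges, k = 2, this is where n > 4 enters. *)
Lemma chord_inj : injective chord.
Proof.
move=> i j /setP e; move: (e (f i)) (e (f (i +% k))).
rewrite !inE !eqxx orbT !(inj_eq fI) (inj_eq (@shift_inj _ _)).
case: (i =P j) => //= _ /esym/eqP ->; rewrite orbF shift_shift addnn => /esym/eqP ejj.
by have := @shift_neq _ j k.*2; rewrite ejj eqxx double_gt0 k0 kn => /(_ isT).
Qed.

Lemma mem_chord i j : (f (j +% k) \in chord i) = (i == j) || (i == j +% k).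
Proof.
by rewrite !inE !(inj_eq fI) (inj_eq (@shift_inj _ _)) orbC !(eq_sym i).
Qed.

End Chords.

(** * Edges of P(n,2), the matching condition at each vertex, and states *)

Section Edges.
Variable n : nat.
Hypothesis n5 : 4 < n.
Implicit Types i j x : 'I_n.

Definition rim i : {set vertex n} := [set v i; v (i +% 1)].
Definition inner i : {set vertex n} := [set u i; u (i +% 2)].

Lemma u_inj : injective (@u n). Proof. by move=> i j []. Qed.
Lemma v_inj : injective (@v n). Proof. by move=> i j []. Qed.

Lemma rim_inj : injective rim.
Proof. by apply: (chord_inj v_inj) => //; apply: leq_trans n5. Qed.

Lemma inner_inj : injective inner.
Proof. exact: (chord_inj u_inj). Qed.

Lemma spoke_inj : injective (@spoke n).
Proof. by move=> i j /setP/(_ (u i)); rewrite !inE eqxx /= orbF => /esym/eqP[]. Qed.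

Lemma rim_inner i j : (rim i == inner j) = false.
Proof. by apply/eqP=> /setP/(_ (v i)); rewrite !inE eqxx. Qed.
Lemma rim_spoke i j : (rim i == spoke j) = false.
Proof. by apply/eqP=> /setP/(_ (u j)); rewrite !inE eqxx. Qed.
Lemma inner_spoke i j : (inner i == spoke j) = false.
Proof. by apply/eqP=> /setP/(_ (v j)); rewrite !inE eqxx. Qed.

Lemma petersen2P e :
  reflect (exists i, [\/ e = rim i, e = inner i | e = spoke i]) (e \in petersen2 n).
Proof.
rewrite !inE; apply: (iffP idP) => [|[i [] ->]].
- by case/orP=> [/orP[]|] /imsetP[i _ ->]; exists i; [apply: Or32|apply: Or33|apply: Or31].
- by rewrite orbC imset_f.
- by rewrite imset_f.
- by rewrite (imset_f (@spoke n)) // orbT.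
Qed.

Lemma v_incident j :
  {in petersen2 n, forall e : {set vertex n},
     (v (j +% 1) \in e) = (e \in [:: rim j; rim (j +% 1); spoke (j +% 1)])}.
Proof.
move=> e /petersen2P[i [] ->]; rewrite !(in_cons, in_nil).
- by rewrite (mem_chord _ v_inj) !(inj_eq rim_inj) rim_spoke !orbF.
- by rewrite !inE inner_spoke !(eq_sym (inner i)) !rim_inner.
- by rewrite !inE !(eq_sym (spoke i)) !rim_spoke (inj_eq v_inj) (inj_eq spoke_inj) !orbF.
Qed.

Lemma u_incident j :
  {in petersen2 n, forall e : {set vertex n},
     (u (j +% 2) \in e) = (e \in [:: inner j; inner (j +% 2); spoke (j +% 2)])}.
Proof.
move=> e /petersen2P[i [] ->]; rewrite !(in_cons, in_nil).
- by rewrite !inE !rim_inner rim_spoke.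
- by rewrite (mem_chord _ u_inj) !(inj_eq inner_inj) inner_spoke !orbF.
- by rewrite !inE !(eq_sym (spoke i)) !inner_spoke (inj_eq u_inj) (inj_eq spoke_inj) !orbF.
Qed.

Lemma v_incident_uniq j : uniq [:: rim j; rim (j +% 1); spoke (j +% 1)].
Proof.
rewrite /= !inE !rim_spoke (inj_eq rim_inj) !orbF !andbT eq_sym.
by apply: shift_neq; apply: leq_trans n5.
Qed.

Lemma u_incident_uniq j : uniq [:: inner j; inner (j +% 2); spoke (j +% 2)].
Proof.
rewrite /= !inE !inner_spoke (inj_eq inner_inj) !orbF !andbT eq_sym.
by apply: shift_neq; apply: leq_trans n5.
Qed.

Lemma perfect_matching_petersen2 (M : {set {set vertex n}}) :
  reflect [/\ M \subset petersen2 n,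
    forall j, (rim j \in M) + (rim (j +% 1) \in M) + (spoke (j +% 1) \in M) = 1 &
    forall j, (inner j \in M) + (inner (j +% 2) \in M) + (spoke (j +% 2) \in M) = 1]
    (perfect_matching (petersen2 n) M).
Proof.
have cv j : M \subset petersen2 n -> #|[set e in M | v (j +% 1) \in e]|
    = (rim j \in M) + (rim (j +% 1) \in M) + (spoke (j +% 1) \in M).
  by move=> sM; rewrite (card_incident sM (v_incident_uniq j) (v_incident j)) /= addn0 addnA.
have cu j : M \subset petersen2 n -> #|[set e in M | u (j +% 2) \in e]|
    = (inner j \in M) + (inner (j +% 2) \in M) + (spoke (j +% 2) \in M).
  by move=> sM; rewrite (card_incident sM (u_incident_uniq j) (u_incident j)) /= addn0 addnA.
rewrite perfect_matchingE; apply: (iffP andP) => [[sM /forallP one]|[sM ov ou]].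
  by split=> // j; apply/eqP; rewrite -?cv -?cu.
split=> //; apply/forallP=> -[] i.
  by have [k _ ->] := shift_surj i 2 i; rewrite -shift_shift cu ?ou.
by have [k _ ->] := shift_surj i 1 i; rewrite -shift_shift cv ?ov.
Qed.

(* The cut between the positions x + k + 1 and x + k + 2, so that the step from
   [k] to [k.+1] reads the edges of the position x + k + 2. *)
Definition state_at (M : {set {set vertex n}}) x (k : nat) : state :=
  (rim (x +% k.+1) \in M, inner (x +% k.+1) \in M, inner (x +% k) \in M).

Definition spoke_step (q t : state) : bool := (used q t).2.

Lemma state_at_step M x k : perfect_matching (petersen2 n) M ->
  step (state_at M x k) (state_at M x k.+1).
Proof.
case/perfect_matching_petersen2=> _ /(_ (x +% k.+1)) + /(_ (x +% k)).
rewrite !shift_shift addn1 addn2 /step /=.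
by do 6 case: (_ \in M).
Qed.

Lemma state_at_spoke M x k : perfect_matching (petersen2 n) M ->
  spoke_step (state_at M x k) (state_at M x k.+1) = (spoke (x +% k.+2) \in M).
Proof.
case/perfect_matching_petersen2=> _ /(_ (x +% k.+1)) + _.
rewrite !shift_shift addn1 /spoke_step /=.
by do 3 case: (_ \in M).
Qed.

Lemma state_at_addn M x k : state_at M x (k + n) = state_at M x k.
Proof. by rewrite /state_at -!addSn !shift_addn. Qed.

Lemma state_at_shift M x k l : state_at M (x +% k) l = state_at M x (k + l).
Proof. by rewrite /state_at !shift_shift !addnS. Qed.

End Edges.

(** * From closed walks back to perfect matchings *)

Section Walks.
Variable n : nat.
Hypothesis n5 : 4 < n.
Implicit Types (i j x : 'I_n) (M S : {set {set vertex n}}) (y : nat -> state).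

Definition select x m (f : 'I_n -> {set vertex n}) (P : pred nat) :=
  [set f (x +% (k + m)) | k : 'I_n & P k].

(** Inverse to [state_at]: the offsets 1 and 0 are those of its first and third components, and 2 is
    the position read by the step from [k]. The second component reappears as the third one of the
    next state. *)
Definition walk_matching x y : {set {set vertex n}} :=
  select x 1 (@rim n) (fun k => (y k).1.1) :|: select x 0 (@inner n) (fun k => (y k).2)
  :|: select x 2 (@spoke n) (fun k => spoke_step (y k) (y k.+1)).

Definition closed_walk y : Prop :=
  (forall k, y (k + n) = y k) /\ (forall k, step (y k) (y k.+1)).

Lemma closed_walk_mod y k l : closed_walk y -> k = l %[mod n] -> y k = y l.
Proof.
have ymod m : closed_walk y -> y m = y (m %% n).
  case=> yn _; rewrite {1}(divn_eq m n) addnC.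
  by elim: (m %/ n) => [|d <-]; rewrite ?addn0 // mulSn addnCA addnC yn.
by move=> cy e; rewrite ymod // e -ymod.
Qed.

Lemma shift_eq_mod x k l : x +% k = x +% l -> k = l %[mod n].
Proof. by move/eqP; rewrite eq_shift => /eqP. Qed.

Lemma mem_select x m f P k : injective f ->
  (forall k l, k = l %[mod n] -> P k = P l) -> (f (x +% (k + m)) \in select x m f P) = P k.
Proof.
move=> fI Pmod; apply/imsetP/idP => [[l] | Pk].
  rewrite inE => Pl /fI /shift_eq_mod /eqP; rewrite eqn_modDr => /eqP e.
  by rewrite (Pmod _ _ e).
have n0 : 0 < n by apply: leq_trans n5.
exists (Ordinal (ltn_pmod k n0)); first by rewrite inE (Pmod _ k) //= modn_mod.
by congr f; apply/eqP; rewrite eq_shift /= modnDml.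
Qed.

Lemma notin_select x m f P e : (forall i, f i == e = false) -> (e \in select x m f P) = false.
Proof. by move=> fe; apply/imsetP => -[l _ /esym/eqP]; rewrite fe. Qed.

Section Membership.
Variables (x : 'I_n) (y : nat -> state).
Hypothesis cy : closed_walk y.

Let ymod k l : k = l %[mod n] -> y k = y l.
Proof. exact: closed_walk_mod. Qed.

Lemma rim_walk k : (rim (x +% k.+1) \in walk_matching x y) = (y k).1.1.
Proof.
rewrite !in_setU -{1}(addn1 k) (mem_select x 1 _ (rim_inj n5)) => [|l l' /ymod-> //].
rewrite !notin_select ?orbF // => i; first by rewrite eq_sym rim_spoke.
by rewrite eq_sym rim_inner.
Qed.

Lemma inner_walk k : (inner (x +% k) \in walk_matching x y) = (y k).2.
Proof.
rewrite !in_setU -{2}(addn0 k) (mem_select x 0 _ (inner_inj n5)) => [|l l' /ymod-> //].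
rewrite !notin_select ?orbF // => i; first by rewrite eq_sym inner_spoke.
by rewrite rim_inner.
Qed.

Lemma spoke_walk k :
  (spoke (x +% k.+2) \in walk_matching x y) = spoke_step (y k) (y k.+1).
Proof.
rewrite !in_setU -{3}(addn2 k) (mem_select x 2 _ (@spoke_inj n)).
  by rewrite !notin_select // => i; rewrite ?rim_spoke ?inner_spoke.
move=> l l' e; rewrite (ymod e) (@ymod l.+1 l'.+1) //.
by apply/eqP; rewrite -(addn1 l) -(addn1 l') eqn_modDr; apply/eqP.
Qed.

Lemma state_at_walk k : state_at (walk_matching x y) x k = y k.
Proof.
rewrite /state_at rim_walk !inner_walk; have [_ /(_ k)] := cy.
by case: (y k) (y k.+1) => -[a b] c [[a' b'] c'] /= /and4P[/eqP->].
Qed.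

Lemma walk_matching_perfect : perfect_matching (petersen2 n) (walk_matching x y).
Proof.
have [_ st] := cy; apply/perfect_matching_petersen2 => //; split=> [|j|j].
- apply/subsetP=> e /setUP[/setUP[]|] /imsetP[k _ ->]; apply/petersen2P; eexists.
  + exact: Or31.
  + exact: Or32.
  + exact: Or33.
- have [k _ ->] := shift_surj x 1 j.
  rewrite shift_shift addn1 (rim_walk k) addn1 (rim_walk k.+1) spoke_walk.
  have := st k; rewrite /spoke_step.
  by case: (y k) (y k.+1) => -[[] []] [] [[[] []] []].
- have [k _ ->] := shift_surj x 0 j.
  rewrite addn0 shift_shift addn2 !inner_walk spoke_walk.
  have := st k; have := st k.+1; rewrite /spoke_step.
  by case: (y k) => -[[] []] []; case: (y k.+1) => -[[] []] []; case: (y k.+2) => -[[] []] [].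
Qed.

End Membership.

Definition letter_at S x k : letter :=
  (rim (x +% k.+2) \in S, inner (x +% k.+2) \in S, spoke (x +% k.+2) \in S).

Lemma walk_matching_sup S x y : S \subset petersen2 n -> closed_walk y ->
  (forall k, k < n -> sub_letter (letter_at S x k) (used (y k) (y k.+1))) ->
  S \subset walk_matching x y.
Proof.
move=> sSE cy sub; apply/subsetP=> e eS.
have /petersen2P[i] := subsetP sSE _ eS; have [k kn ->] := shift_surj x 2 i.
rewrite addn2; have [_ /(_ k) st] := cy.
have /and3P[/implyP s1 /implyP s2 /implyP s3] := sub k kn.
case=> ee; rewrite ee in eS *.
- by rewrite rim_walk //; apply: s1.
(* [used] reads the inner edge in the second component of [y k.+1], the matching in the third
   component of [y k.+2]; the step between them identifies the two. *)
- have := s2 eS; rewrite inner_walk // => h.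
  have [_ /(_ k.+1)] := cy; move: h.
  by case: (y k.+1) (y k.+2) => -[a b] c [[a' b'] c'] /= -> /and4P[/eqP->].
- by rewrite spoke_walk //; apply: s3.
Qed.

(** The list [p] omits the start; for a closed walk its last state is [q] again, so the period is
    [size p]. *)
Definition cyclic (q : state) (p : seq state) (k : nat) : state :=
  nth q (q :: p) (k %% size p).

Lemma cyclicS q p k : 0 < size p -> last q p = q ->
  cyclic q p k.+1 = nth q p (k %% size p).
Proof.
move=> p0 lp; rewrite /cyclic -addn1 -modnDml addn1.
have := ltn_pmod k p0; rewrite leq_eqVlt => /orP[/eqP e|lt]; last by rewrite modn_small.
by rewrite e modnn /= -[X in nth _ _ X]/(_.+1.-1) e nth_last.
Qed.

Lemma closed_walk_cyclic q p : size p = n -> last q p = q -> path step q p ->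
  closed_walk (cyclic q p).
Proof.
move=> sp lp /(pathP q) st; have n0 : 0 < size p by rewrite sp; apply: leq_trans n5.
split=> k; first by rewrite /cyclic sp modnDr.
by rewrite cyclicS //; apply: st; rewrite ltn_pmod.
Qed.

Lemma runP q ls p : reflect (size ls = size p /\
    forall k, k < size p -> allows (nth (false, false, false) ls k) (nth q (q :: p) k) (nth q p k))
  (run q ls p).
Proof.
apply: (iffP idP) => [r|[sz r]].
  split=> [|k]; first exact: run_size r.
  elim: ls q p r k => [|l ls IH] q [|t p] //= /andP[lt /IH r] [|k] //= kp.
  have := r k kp; rewrite !(@set_nth_default _ _ q t k) //=.
  exact: ltnW kp.
elim: ls q p sz r => [|l ls IH] q [|t p] //= [sz] r.
rewrite (r 0 isT); apply: IH => // k kp; have := r k.+1 kp.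
by rewrite /= !(@set_nth_default _ _ t q k) //= ltnW.
Qed.

Lemma letter_at_sub S M x k : perfect_matching (petersen2 n) M -> S \subset M ->
  sub_letter (letter_at S x k) (used (state_at M x k) (state_at M x k.+1)).
Proof.
move=> pM /subsetP sSM; apply/and3P; split; apply/implyP=> /sSM //.
by rewrite -(state_at_spoke n5 _ _ pM).
Qed.

(** Over one full turn the rim, inner and spoke edges read are pairwise distinct, so no edge of [S]
    is counted twice. *)
Lemma num_forced_le S x : num_forced [seq letter_at S x k | k <- iota 0 n] <= #|S|.
Proof.
have uni (f : 'I_n -> {set vertex n}) : injective f ->
    uniq [seq f (x +% k.+2) | k <- iota 0 n].
  move=> fI; rewrite map_inj_in_uniq ?iota_uniq // => k l.
  rewrite !mem_iota /= !add0n => kn ln /fI; rewrite -(addn2 k) -(addn2 l) => /shift_eq_mod /eqP.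
  by rewrite eqn_modDr !modn_small // => /eqP.
pose es := [seq rim (x +% k.+2) | k <- iota 0 n] ++ [seq inner (x +% k.+2) | k <- iota 0 n]
  ++ [seq spoke (x +% k.+2) | k <- iota 0 n].
have ues : uniq es.
  rewrite !cat_uniq !uni ?andbT /=; [|exact: spoke_inj|exact: inner_inj|exact: rim_inj].
  apply/andP; split; apply/hasPn => e.
    rewrite mem_cat => /orP[] /mapP[k _ ->]; apply/mapP => -[l _ /eqP].
      by rewrite eq_sym rim_inner.
    by rewrite eq_sym rim_spoke.
  by case/mapP=> k _ ->; apply/mapP => -[l _ /eqP]; rewrite eq_sym inner_spoke.
have -> : num_forced [seq letter_at S x k | k <- iota 0 n] = count (mem S) es.
  rewrite !count_cat !count_map /num_forced -map_comp addnA.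
  elim: (iota 0 n) => //= k ks ->; rewrite /letter_size /=; lia.
rewrite -size_filter -(card_uniqP _) ?filter_uniq //.
by apply: subset_leq_card; apply/subsetP=> e; rewrite mem_filter => /andP[].
Qed.

Lemma forcing_set_ge M S x : 11 <= n -> perfect_matching (petersen2 n) M ->
  state_at M x 0 = base -> forcing_set (petersen2 n) M S -> n + 12 <= 12 * #|S|.
Proof.
move=> n11 pM s0 /andP[sSM /forallP uM].
pose ls := [seq letter_at S x k | k <- iota 0 n].
pose p := [seq state_at M x k | k <- iota 1 n].
have sls : size ls = n by rewrite size_map size_iota.
have sp : size p = n by rewrite size_map size_iota.
have lsE k : k < n -> nth (false, false, false) ls k = letter_at S x k.
  by move=> kn; rewrite (nth_map 0) ?size_iota // nth_iota.
have pE q k : k < n -> nth q p k = state_at M x k.+1.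
  by move=> kn; rewrite (nth_map 0) ?size_iota // nth_iota.
have n0 : 0 < n by apply: leq_trans n5.
have lp : last base p = base.
  rewrite -nth_last sp pE ?prednK //.
  by have := state_at_addn M x 0; rewrite add0n => ->.
apply: leq_trans (leq_mul (leqnn 12) (num_forced_le S x)).
rewrite -{1}sls; apply: unrivaled_num_forced (lp) _ _; last by rewrite sls.
  apply/runP; split=> [|k]; rewrite sp // => kn.
  rewrite lsE // pE //; case: k kn => [|k] kn /=.
    by rewrite -s0 /allows state_at_step // letter_at_sub.
  by rewrite pE ?(ltnW kn) // /allows state_at_step // letter_at_sub.
(* A closed walk containing the letters of [S] gives a perfect matching containing [S], hence [M];
   reading its states back identifies [q] and [p']. *)
move=> q p' r lp'; have /runP[sz al] := r; rewrite sls in sz; rewrite -sz in al.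
have cy := closed_walk_cyclic (esym sz) lp' (run_step r).
have yE k : k < n -> cyclic q p' k.+1 = nth q p' k.
  by move=> kn; rewrite cyclicS -?sz // modn_small.
have yE' k : k < n -> cyclic q p' k = nth q (q :: p') k.
  by move=> kn; rewrite /cyclic -sz modn_small.
have sSE : S \subset petersen2 n.
  by apply: subset_trans sSM _; case/and3P: pM.
have sSW : S \subset walk_matching x (cyclic q p').
  apply: walk_matching_sup => // k kn; rewrite yE // yE' // -lsE //.
  by have /andP[] := al k kn.
have := uM (walk_matching x (cyclic q p')).
rewrite sSW walk_matching_perfect //= => /eqP WM.
have yM k : cyclic q p' k = state_at M x k by rewrite -WM state_at_walk.
split; first by rewrite -s0 -yM /cyclic mod0n.
apply: (@eq_from_nth _ base) => [|k]; rewrite ?sp // -sz => kn.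
by rewrite pE // -yM yE // (set_nth_default q) // -sz.
Qed.

End Walks.

(** * Forcing sets of size [ceil (n / 12) + 1] *)

Fixpoint paths (m : nat) (q : state) : seq (seq state) :=
  if m is m'.+1 then
    flatten [seq [seq t :: p | p <- paths m' t] | t <- [seq t <- bools3 | step q t]]
  else [:: [::]].

Lemma mem_paths q p : path step q p -> p \in paths (size p) q.
Proof.
elim: p q => [|t p IH] q //= /andP[qt /IH pt].
have tq : t \in [seq t <- bools3 | step q t] by rewrite mem_filter qt mem_bools3.
by apply/flatten_mapP; exists t => //; apply: map_f.
Qed.

Definition ends_in_spoke (p : seq state) : bool :=
  spoke_step (nth base (base :: p) (size p).-1) (last base p).

Definition segment (g : nat) : seq state :=
  head [::] [seq p <- paths g base | ends_in_spoke p].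

(** A walk of length g from [base] ending in a spoke is a composition of g - 3 into blocks 3 and 4,
    then a last block 3. The numbers 3, 4, 6, 8 and 9 have just one such composition. *)
Definition gap : pred nat := mem [:: 6; 7; 9; 11; 12].

Lemma segmentP g : gap g ->
  [/\ [seq p <- paths g base | ends_in_spoke p] = [:: segment g],
      path step base (segment g), last base (segment g) = base & size (segment g) = g].
Proof.
have : all (fun g => [&& [seq p <- paths g base | ends_in_spoke p] == [:: segment g],
      path step base (segment g), last base (segment g) == base & size (segment g) == g])
   [:: 6; 7; 9; 11; 12] by vm_compute.
by move=> /allP h /h /and4P[/eqP ? ? /eqP ? /eqP].
Qed.

Lemma last_iota (y : nat -> state) k g : last (y k) [seq y j | j <- iota k.+1 g] = y (k + g).
Proof.
by rewrite last_map; congr y; elim: g k => [|g IH] k /=; rewrite ?addn0 // IH addSnnS.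
Qed.

Lemma path_iota (y : nat -> state) k g : (forall k, step (y k) (y k.+1)) ->
  path step (y k) [seq y j | j <- iota k.+1 g].
Proof. by move=> st; elim: g k => //= g IH k; rewrite st IH. Qed.

Lemma ends_in_spoke_iota (y : nat -> state) k g : 0 < g -> y k = base ->
  ends_in_spoke [seq y j | j <- iota k.+1 g] = spoke_step (y (k + g).-1) (y (k + g)).
Proof.
case: g => // g _ yk; have := last_iota y k g.+1; rewrite /ends_in_spoke yk => ->.
rewrite size_map size_iota /= addnS /=.
congr spoke_step; case: g => [|g] /=; first by rewrite addn0.
by rewrite -[_ :: _]/[seq y j | j <- iota k.+1 g.+2] (nth_map 0) ?size_iota // nth_iota // addSnnS.
Qed.

Lemma segment_unique (y : nat -> state) k g : gap g -> (forall k, step (y k) (y k.+1)) ->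
  y k = base -> spoke_step (y (k + g).-1) (y (k + g)) ->
  [seq y j | j <- iota k.+1 g] = segment g.
Proof.
move=> gg st yk sp; have [eg _ _ _] := segmentP gg.
have g0 : 0 < g by case: g gg {sp eg}.
apply/eqP; rewrite -mem_seq1 -eg mem_filter ends_in_spoke_iota // sp /=.
by have := mem_paths (path_iota k g st); rewrite yk size_map size_iota.
Qed.

(* [scanl addn k gs] lists the right ends of consecutive gaps of lengths [gs]
   that start at [k]. *)
Lemma gaps_unique (y : nat -> state) k gs : all gap gs -> (forall k, step (y k) (y k.+1)) ->
  y k = base -> all (fun m => spoke_step (y m.-1) (y m)) (scanl addn k gs) ->
  [seq y j | j <- iota k.+1 (sumn gs)] = flatten [seq segment g | g <- gs].
Proof.
move=> + st; elim: gs k => //= g gs IH k /andP[gg ags] yk /andP[sp asp].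
have eg := segment_unique gg st yk sp.
rewrite iotaD map_cat eg addSn IH //.
by have [_ _ <- _] := segmentP gg; rewrite -eg -yk last_iota.
Qed.

Lemma gaps_spokes (y : nat -> state) k gs : all gap gs -> y k = base ->
  [seq y j | j <- iota k.+1 (sumn gs)] = flatten [seq segment g | g <- gs] ->
  all (fun m => spoke_step (y m.-1) (y m)) (scanl addn k gs).
Proof.
elim: gs k => //= g gs IH k /andP[gg ags] yk.
have [eg _ lg sg] := segmentP gg; have g0 : 0 < g by case: g gg {eg lg sg}.
rewrite iotaD map_cat => /eqP; rewrite eqseq_cat ?size_map ?size_iota // addSn.
case/andP=> /eqP e1 /eqP e2; rewrite -ends_in_spoke_iota // e1.
have : segment g \in [:: segment g] by rewrite mem_seq1.
rewrite -eg mem_filter => /andP[-> _] /=; apply: IH => //.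
by rewrite -last_iota yk e1.
Qed.

Lemma flatten_segments gs : all gap gs ->
  let p := flatten [seq segment g | g <- gs] in
  [/\ path step base p, last base p = base & size p = sumn gs].
Proof.
elim: gs => //= g gs IH /andP[/segmentP[_ pg lg sg] /IH[pgs lgs sgs]].
by rewrite cat_path last_cat size_cat lg pg pgs lgs sg sgs.
Qed.

Lemma scanl_last (P : pred nat) k g gs : all P (scanl addn k (g :: gs)) ->
  P (k + sumn (g :: gs)).
Proof.
elim: gs g k => [|h gs IH] g k; first by rewrite /= addn0 andbT.
by case/andP=> _ /IH /=; rewrite -addnA.
Qed.

Lemma gaps_exist n : 11 <= n ->
  exists gs, [/\ all gap gs, sumn gs = n & size gs = (n + 11) %/ 12].
Proof.
move=> n11; have [n12|n13] := leqP n 12.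
  exists [:: n]; rewrite /= addn0; split=> //; last by lia.
  by have /orP[/eqP->|/eqP->] : (n == 11) || (n == 12) by lia.
(* Entry [r] is a pair of gaps of sum r + 13; gaps of length 12 make up the rest of n. *)
pose tails := [:: [:: 6; 7]; [:: 7; 7]; [:: 6; 9]; [:: 7; 9]; [:: 6; 11]; [:: 6; 12];
  [:: 7; 12]; [:: 9; 11]; [:: 9; 12]; [:: 11; 11]; [:: 11; 12]; [:: 12; 12]].
pose r := (n - 13) %% 12; pose m := (n - 13) %/ 12.
have [nE r12] : n = m * 12 + r + 13 /\ r < 12 by rewrite -divn_eq ltn_mod; lia.
have tailP k : k < 12 -> let s := nth [::] tails k in
    [&& all gap s, sumn s == k + 13 & size s == 2].
  by do 12! [case: k => [//|k]].
have /and3P[ga /eqP su /eqP si] := tailP r r12.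
exists (nseq m 12 ++ nth [::] tails r); split.
- by rewrite all_cat ga all_nseq orbT.
- by rewrite sumn_cat sumn_nseq su; lia.
- by rewrite size_cat size_nseq si; lia.
Qed.

(** * Spoke distances, membership in M_2, and sets of pins that force a matching *)

Section Class.
Variable n : nat.
Hypothesis n5 : 4 < n.
Implicit Types (i j x : 'I_n) (M S : {set {set vertex n}}) (y : nat -> state).

Lemma spoke_excludes M i : perfect_matching (petersen2 n) M -> spoke i \in M ->
  rim i \notin M /\ inner i \notin M.
Proof.
case/(perfect_matching_petersen2 n5) => _ ov ou si.
have [k1 _ e1] := shift_surj i 1 i; have [k2 _ e2] := shift_surj i 2 i.
have := ov (i +% k1); have := ou (i +% k2); rewrite !shift_shift -e1 -e2 si.
by do 4 case: (_ \in M).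
Qed.

(** Without spokes each parity class is a single cycle of four states, listed in [orbit]. Exactly
    one of them can be left by a spoke: the third if [c] holds, the first otherwise. *)
Lemma spokeless_run y c d : y 0 = (false, false, c) -> (forall k, step (y k) (y k.+1)) ->
  0 < d -> (forall k, k.+1 < d -> ~~ spoke_step (y k) (y k.+1)) ->
  spoke_step (y d.-1) (y d) -> d.-1 %% 4 = if c then 2 else 0.
Proof.
move=> y0 st d0 nsp sp.
pose orbit := nth base (if c
  then [:: (false, false, true); (true, false, false); (false, true, false); (true, true, true)]
  else [:: (false, false, false); (true, true, false); (false, true, true); (true, false, true)]).
have yE k : k < d -> y k = orbit (k %% 4).
  elim: k => [_|k IH kd]; first by rewrite y0 /orbit mod0n; case: (c).
  have := IH (ltnW kd); have := nsp k kd; have := st k; rewrite -(addn1 k) -modnDml.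
  have := ltn_pmod k (isT : 0 < 4); rewrite /orbit /spoke_step.
  case: (k %% 4) => [|[|[|[|r]]]] // _ + + yk; rewrite yk addn1;
    by case: c {orbit y0 IH yk} (y k.+1) => -[[[] []] []].
have := yE d.-1; rewrite prednK // => /(_ (leqnn _)) yd.
have := st d.-1; move: sp; rewrite prednK // yd /orbit /spoke_step.
have := ltn_pmod d.-1 (isT : 0 < 4).
case: (d.-1 %% 4) => [|[|[|[|r]]]] // _; case: c {yE orbit yd y0} (y d) => -[[[] []] []] //.
Qed.

Lemma consecutive_spokes_mod M x d : perfect_matching (petersen2 n) M ->
  consecutive_spokes M (x +% 1) d ->
  state_at M x 0 = (false, false, (state_at M x 0).2) /\
  (d - 1) %% 4 = if (state_at M x 0).2 then 2 else 0.
Proof.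
move=> pM [/andP[d0 dn] s0 sd ns].
have [/negPf r0 /negPf i0] := spoke_excludes pM s0.
have y0 : state_at M x 0 = (false, false, (state_at M x 0).2) by rewrite /state_at r0 i0.
split=> //; rewrite subn1; apply: (spokeless_run y0 _ d0) => [k|k kd|].
- exact: state_at_step.
- by rewrite state_at_spoke // -[k.+2]add1n -shift_shift ns.
- case: d d0 sd {dn ns} => // d _; rewrite shift_shift add1n => sd.
  by rewrite state_at_spoke.
Qed.

Lemma exists_next_spoke M i : spoke i \in M -> exists d, consecutive_spokes M i d.
Proof.
move=> si; have n0 : 0 < n by apply: leq_trans n5.
have ex : exists d, (0 < d) && (spoke (i +% d) \in M).
  by exists n; rewrite n0 -[n in _ +% n]add0n shift_addn shift0.
case: (ex_minnP ex) => d /andP[d0 sd] dmin; exists d; split=> //.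
  by rewrite d0 dmin // n0 -[n in _ +% n]add0n shift_addn shift0.
by move=> k /andP[k0 kd]; apply/negP => sk; move: (dmin k); rewrite k0 sk leqNgt kd => /(_ isT).
Qed.

(** The state just after a spoke is (0,0,c), and a following gap of residue 2 means that c holds. *)
Lemma class2_base M : matching_class2 M -> exists x, state_at M x 0 = base.
Proof.
case=> pM [[[i si] cons]|[_ n4 [i eM]]].
  have [d cd] := exists_next_spoke si; have dmod := cons i d cd.
  have [k _ ei] := shift_surj i 1 i; exists (i +% k).
  move: cd; rewrite {1}ei -shift_shift => /(consecutive_spokes_mod pM) [e1 e2].
  by move: dmod; rewrite e2 e1 /=; case: (_ \in M).
(* In the spokeless case the block k = 0 already covers v_(i+2) and u_(i+2), which excludes the rim
   and inner edges leaving position i + 2. *)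
exists (i +% 1); rewrite /state_at !shift_shift addn1.
have n40 : 0 < n %/ 4 by rewrite divn_gt0 // ltnW.
have inM e : e \in [set [set u (i +% (4 * 0)); u (i +% (4 * 0 + 2))];
         [set u (i +% (4 * 0 + 1)); u (i +% (4 * 0 + 3))];
         [set v (i +% (4 * 0 + 1)); v (i +% (4 * 0 + 2))];
         [set v (i +% (4 * 0 + 3)); v (i +% (4 * 0 + 4))]] -> e \in M.
  by move=> ei; rewrite eM; apply/bigcupP; exists (Ordinal n40).
have r1 : rim (i +% 1) \in M by apply: inM; rewrite /rim shift_shift !inE eqxx !orbT.
have i0 : inner i \in M by apply: inM; rewrite /inner !inE shift0 eqxx.
have i1 : inner (i +% 1) \in M by apply: inM; rewrite /inner shift_shift !inE eqxx !orbT.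
have /perfect_matching_petersen2 [//|_ /(_ (i +% 1)) + /(_ i)] := pM.
rewrite shift_shift r1 i0 i1.
by case: (rim _ \in M); case: (inner _ \in M).
Qed.

Definition parity (q : state) : bool := q.1.1 (+) q.1.2 (+) q.2.

Lemma step_parity q t : step q t -> parity t = parity q.
Proof. by case: q t => -[[] []] [] [[[] []] []]. Qed.

(** Parity stays odd all along the walk, so the state after any spoke is [base], which gives residue
    2 for the next gap. *)
Lemma base_class2 M x : perfect_matching (petersen2 n) M -> state_at M x 0 = base ->
  (exists i, spoke i \in M) -> matching_class2 M.
Proof.
move=> pM s0 sp; split=> //; left; split=> // i d.
have par k : parity (state_at M x k).
  by elim: k => [|k IH]; [rewrite s0|rewrite (step_parity (state_at_step n5 x k pM))].
have [k _ ->] := shift_surj x 1 i; rewrite -shift_shift.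
case/(consecutive_spokes_mod pM) => e ->.
by have := par k; rewrite -[k in state_at M x k]addn0 -state_at_shift e /parity /= => ->.
Qed.

Lemma state_at_inj M M' x : perfect_matching (petersen2 n) M ->
  perfect_matching (petersen2 n) M' -> state_at M x =1 state_at M' x -> M = M'.
Proof.
move=> pM pM' e; apply/setP=> f.
case: (boolP (f \in petersen2 n)) => [/petersen2P[i]|nf]; last first.
  have out N : perfect_matching (petersen2 n) N -> f \in N = false.
    by case/and3P=> /subsetP sN _ _; apply: contraNF nf => /sN.
  by rewrite !out.
have [k _ ->] := shift_surj x 2 i; rewrite addn2 => -[]->.
- by case: (e k.+1).
- by case: (e k.+1).
- by rewrite -!(state_at_spoke n5) // !e.
Qed.

Lemma set0_petersen2 : set0 \notin petersen2 n.
Proof.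
by apply/petersen2P => -[i [] /setP]; [move/(_ (v i))|move/(_ (u i))|move/(_ (u i))];
  rewrite !inE eqxx.
Qed.

Lemma forcing_numberP M : perfect_matching (petersen2 n) M ->
  (exists2 S, forcing_set (petersen2 n) M S & #|S| = forcing_number (petersen2 n) M) /\
  (forall S, forcing_set (petersen2 n) M S -> forcing_number (petersen2 n) M <= #|S|).
Proof.
move=> pM; rewrite /forcing_number.
case: arg_minnP => [|S fS minS]; first exact: forcing_set_refl set0_petersen2 pM.
by split=> //; exists S.
Qed.

(** By the indexing of [state_at], the spoke at [x +% m.+1] is read by the step into state number
    m. *)
Definition pins x (gs : seq nat) : seq {set vertex n} :=
  inner x :: [seq spoke (x +% m.+1) | m <- scanl addn 0 gs].

Lemma scanl_gaps_gt0 k gs : all gap gs -> all (ltn 0) (scanl addn k gs).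
Proof.
elim: gs k => //= g gs IH k /andP[gg /IH->]; rewrite andbT addn_gt0.
by case: g gg => [|g]; rewrite ?orbT.
Qed.

(** The last partial sum is n, so the last pin is the spoke at [x +% 1]. It excludes the rim and
    inner edges there, and [inner x] supplies the third component of [base]. *)
Lemma pins_state M x gs : perfect_matching (petersen2 n) M ->
  all gap gs -> sumn gs = n -> {subset pins x gs <= M} -> state_at M x 0 = base.
Proof.
case: gs => [|g gs] pM ags sg sub; first by have : 4 < sumn [::] by rewrite sg.
have /scanl_last : all (fun m => spoke (x +% m.+1) \in M) (scanl addn 0 (g :: gs)).
  by apply/allP=> m mg; apply: sub; rewrite inE (map_f (fun m => spoke (x +% m.+1))) ?orbT.
rewrite sg add0n -[n.+1]/(1 + n) shift_addn => /(spoke_excludes pM)[/negPf r /negPf i].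
by rewrite /state_at r i shift0 sub // inE eqxx.
Qed.

Lemma pins_spokes M x gs : perfect_matching (petersen2 n) M -> all gap gs ->
  {subset pins x gs <= M} ->
  all (fun m => spoke_step (state_at M x m.-1) (state_at M x m)) (scanl addn 0 gs).
Proof.
move=> pM ags sub; apply/allP=> m mg.
have m0 : 0 < m by have /allP/(_ m mg) := scanl_gaps_gt0 0 ags.
rewrite -{2}(prednK m0) state_at_spoke // prednK //.
by apply: sub; rewrite inE (map_f (fun m => spoke (x +% m.+1))) ?orbT.
Qed.

Lemma eq_closed_walk y y' : closed_walk n y -> closed_walk n y' ->
  [seq y k | k <- iota 1 n] = [seq y' k | k <- iota 1 n] -> y =1 y'.
Proof.
move=> cy cy' e k; have n0 : 0 < n by apply: leq_trans n5.
(* The list runs over the indices 1 to n, so [k] is reduced to its representative in that range. *)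
have km : k = (k + n.-1) %% n + 1 %[mod n].
  by rewrite modnDml -addnA addn1 prednK // modnDr.
rewrite (closed_walk_mod cy km) (closed_walk_mod cy' km) addn1.
have := congr1 (fun s => nth base s ((k + n.-1) %% n)) e.
by rewrite !(nth_map 0) ?size_iota ?ltn_pmod // nth_iota ?ltn_pmod.
Qed.

(** [M] is read off the concatenated segments. Any perfect matching containing the pins is at [base]
    at index 0 and has spokes at the partial sums, so [gaps_unique] gives it the same states. *)
Lemma exists_forcing_pins x gs : all gap gs -> sumn gs = n ->
  exists2 M, matching_class2 M & forcing_set (petersen2 n) M [set e in pins x gs].
Proof.
move=> ags sg; have [pp lp sp] := flatten_segments ags.
set p := flatten _ in pp lp sp; rewrite sg in sp.
pose y := cyclic base p.
have cy : closed_walk n y by apply: closed_walk_cyclic.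
have [_ sty] := cy.
have n0 : 0 < n by apply: leq_trans n5.
have yp : [seq y k | k <- iota 1 (sumn gs)] = p.
  rewrite sg; apply: (@eq_from_nth _ base) => [|k]; rewrite size_map size_iota ?sp // => kn.
  by rewrite (nth_map 0) ?size_iota // nth_iota // /y cyclicS ?sp // modn_small.
have y0 : y 0 = base by rewrite /y /cyclic mod0n.
pose M := walk_matching x y.
have pM : perfect_matching (petersen2 n) M by apply: walk_matching_perfect.
have MY k : state_at M x k = y k by apply: state_at_walk.
have sp0 := gaps_spokes ags y0 yp.
have sub : {subset pins x gs <= M}.
  move=> e; rewrite inE => /orP[/eqP->|/mapP[m mg ->]].
    by rewrite -[x]shift0 inner_walk // y0.
  have m0 : 0 < m by have /allP/(_ m mg) := scanl_gaps_gt0 0 ags.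
  by rewrite -(prednK m0) spoke_walk // prednK //; have /allP/(_ m mg) := sp0.
exists M.
  apply: (base_class2 pM (x := x)); first by rewrite MY.
  have [g [gs' eg]] : exists g gs', gs = g :: gs'.
    by case: (gs) sg n5 => [<-|g gs'] //; exists g, gs'.
  by exists (x +% g.+1); apply: sub; rewrite eg !inE eqxx orbT.
rewrite /forcing_set; apply/andP; split.
  by apply/subsetP=> e; rewrite inE => /sub.
apply/forallP=> M'; apply/implyP=> /andP[pM' /subsetP sM'].
have sub' : {subset pins x gs <= M'} by move=> e es; apply: sM'; rewrite inE.
have cy' : closed_walk n (state_at M' x).
  by split=> k; [apply: state_at_addn|apply: state_at_step].
apply/eqP/(state_at_inj (x := x) pM' pM) => k; rewrite MY.
have [_ st'] := cy'.
have := gaps_unique ags st' (pins_state pM' ags sg sub') (pins_spokes pM' ags sub').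
by rewrite -/p -yp sg => /(eq_closed_walk cy' cy)/(_ k).
Qed.

End Class.

(** * The minimum forcing number over M_2 *)

Lemma forcing_number_bounds n (M : {set {set vertex n}}) : 11 <= n -> matching_class2 M ->
  (n + 11) %/ 12 + 1 <= forcing_number (petersen2 n) M.
Proof.
move=> n11 cM; have n5 : 4 < n by apply: leq_trans n11.
have [x s0] := class2_base n5 cM; have [pM _] := cM.
have [[S fS <-] _] := forcing_numberP pM.
by have := forcing_set_ge n5 n11 pM s0 fS; lia.
Qed.

Lemma exists_forcing_number n : 11 <= n ->
  exists2 M : {set {set vertex n}}, matching_class2 M &
    forcing_number (petersen2 n) M = (n + 11) %/ 12 + 1.
Proof.
move=> n11; have n5 : 4 < n by apply: leq_trans n11.
have [gs [ags sg zg]] := gaps_exist n11.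
pose x := Ordinal (leq_trans (isT : 0 < 11) n11).
have [M cM fM] := exists_forcing_pins n5 x ags sg; exists M => //.
apply/eqP; rewrite eqn_leq forcing_number_bounds // andbT.
have [pM _] := cM; have [_ /(_ _ fM)] := forcing_numberP pM.
move/leq_trans; apply; rewrite cardsE; apply: leq_trans (card_size _) _.
by rewrite /pins /= size_map size_scanl zg addn1.
Qed.

(* Imported only now: [all_algebra] rebinds [%Z] to [int]. *)
From mathcomp Require Import all_order all_algebra.
Import GRing.Theory Num.Theory.
Local Open Scope ring_scope.

Lemma ceil_div12 (n : nat) : Num.ceil (n%:R / 12%:R : rat) = ((n + 11) %/ 12)%N%:Z.
Proof.
apply: ceil_def; rewrite ltr_pdivlMr ?ler_pdivrMr ?ltr0n //.
rewrite rmorphB /= mulr1z mulrBl mul1r ltrBlDr -!pmulrn -natrM -natrD ltr_nat ler_nat.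
by apply/andP; split; lia.
Qed.

Theorem theorem4p2 (n : nat) (hn : (11 <= n)%N) :
  (exists2 M : {set {set vertex n}},
     matching_class2 M &
     (forcing_number (petersen2 n) M)%:Z = Num.ceil (n%:R / 12%:R : rat) + 1)
  /\
  (forall M : {set {set vertex n}},
     matching_class2 M ->
     Num.ceil (n%:R / 12%:R : rat) + 1 <= (forcing_number (petersen2 n) M)%:Z).
Proof.
rewrite ceil_div12; split=> [|M cM].
  by have [M cM fM] := exists_forcing_number hn; exists M => //; rewrite fM PoszD.
by have := forcing_number_bounds hn cM; rewrite -lez_nat PoszD.
Qed.
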